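(* Let $\lambda$ be a nonzero real number. For every integer $n\ge 1$, $$2^{n}\beta_{n,\frac{\lambda}{2}}-\beta_{n,\lambda}=n\sum_{k=0}^{n-1}{n-1 \brace k}_{\lambda}(-1)^{k-1}k!\,2^{-k-1}=-\frac{n}{2}\,\mathcal{E}_{n-1,\lambda}.$$
   Context: For a nonzero real $\mu$, the degenerate falling factorials are $(x)_{0,\mu}=1$ and $(x)_{n,\mu}=x(x-\mu)(x-2\mu)\cdots(x-(n-1)\mu)$ for $n\ge 1$; the falling factorials are $(x)_0=1$, $(x)_n=x(x-1)\cdots(x-n+1)$ for $n\ge1$. The degenerate Stirling numbers of the second kind ${n \brace k}_{\mu}$ ($0\le k\le n$) are defined by the polynomial identity $(x)_{n,\mu}=\sum_{k=0}^{n}{n \brace k}_{\mu}(x)_k$, $n\ge 0$. The degenerate exponential is $e_{\mu}(t)=\sum_{n=0}^{\infty}(1)_{n,\mu}\frac{t^{n}}{n!}$ (that is, $(1+\mu t)^{1/\mu}$). The degenerate Bernoulli numbers $\beta_{n,\mu}$ are defined by $\frac{t}{e_{\mu}(t)-1}=\sum_{n=0}^{\infty}\beta_{n,\mu}\frac{t^{n}}{n!}$, and the degenerate Euler numbers $\mathcal{E}_{n,\mu}$ by $\frac{2}{e_{\mu}(t)+1}=\sum_{n=0}^{\infty}\mathcal{E}_{n,\mu}\frac{t^{n}}{n!}$. *)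

(* Defs.v *)
From mathcomp Require Import all_boot all_order all_algebra.
From mathcomp Require Import boolp classical_sets reals.
From mathcomp Require Import zify ring.

Set Implicit Arguments.
Unset Strict Implicit.
Unset Printing Implicit Defensive.

Import Order.TTheory GRing.Theory Num.Theory.

Local Open Scope ring_scope.

(* A formal power series is represented by its sequence of coefficients.
   Addition and subtraction are pointwise ([\+], [\-]); multiplication and
   constants are not those of the pointwise ring [nat -> R]. *)
Section PowerSeries.
Variable R : realType.
Implicit Types (f g h a : nat -> R) (c mu : R).

Definition fps_const c : nat -> R := fun n => if n == 0%N then c else 0.

Definition fps_X : nat -> R := fun n => if n == 1%N then 1 else 0.

Definition fps_mul f g : nat -> R := fun n => \sum_(i < n.+1) f i * g (n - i)%N.

(* The quotient f / g in R[[t]], i.e. the series h such that h g = f; the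
   value is irrelevant when no such h exists. See [fps_mul_inj] and
   [fps_divP] for uniqueness and existence. *)
Definition fps_div f g : nat -> R :=
  xget (fps_const 0) [set h | fps_mul h g = f]%classic.

Definition egf a : nat -> R := fun n => a n / n`!%:R.

(* The polynomial (x)_{n,mu}; the falling factorial (x)_n is the case mu = 1. *)
Definition degen_ffact mu n : {poly R} := \prod_(i < n) ('X - (i%:R * mu)%:P).

Definition degen_exp mu : nat -> R := egf (fun n => (degen_ffact mu n).[1]).

Definition degen_bernoulli mu n : R :=
  n`!%:R * fps_div fps_X (degen_exp mu \- fps_const 1) n.

Definition degen_euler mu n : R :=
  n`!%:R * fps_div (fps_const 2) (degen_exp mu \+ fps_const 1) n.

(* The sequence of connection coefficients of (x)_{n,mu} in the basis
   (x)_0, ..., (x)_n, extended by zero; see [degen_stirling2P] and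
   [degen_stirling2_uniq]. *)
Definition is_degen_stirling2 mu n (s : nat -> R) : Prop :=
  (forall k, (n < k)%N -> s k = 0) /\
  degen_ffact mu n = \sum_(k < n.+1) s k *: degen_ffact 1 k.

Definition degen_stirling2 mu n : nat -> R :=
  xget (fps_const 0) [set s | is_degen_stirling2 mu n s]%classic.

Lemma fps_mul_order g m h n : (forall i, (i < m)%N -> g i = 0) ->
  fps_mul h g (n + m)%N =
    \sum_(i < n) h i * g (n + m - i)%N + h n * g m.
Proof.
move=> g0; rewrite /fps_mul -(big_mkord xpredT (fun i => h i * g (n + m - i)%N)).
rewrite (@big_cat_nat _ _ _ n.+1) //=; last by rewrite ltnS leq_addr.
rewrite big_nat_recr //= addKn big_mkord.
rewrite [\sum_(n.+1 <= i < _) _]big_nat_cond [X in _ + X = _]big1 ?addr0 //.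
move=> i /andP[/andP[ni inm] _]; rewrite g0 ?mulr0 //; lia.
Qed.

Lemma fps_mul_inj g m h1 h2 :
  (forall i, (i < m)%N -> g i = 0) -> g m != 0 ->
  fps_mul h1 g = fps_mul h2 g -> h1 = h2.
Proof.
move=> g0 gm E; apply/funext => n; elim/ltn_ind: n => n IH.
have := congr1 (fun f => f (n + m)%N) E; rewrite !fps_mul_order //.
under eq_bigr => i _ do rewrite IH //.
by move=> /addrI /(mulIf gm).
Qed.

Lemma fps_div_exists f g m :
  (forall i, (i < m)%N -> g i = 0) -> g m != 0 ->
  (forall i, (i < m)%N -> f i = 0) -> exists h, fps_mul h g = f.
Proof.
move=> g0 gm f0.
pose step (s : seq R) := rcons s
  ((f (size s + m)%N - \sum_(i < size s) s`_i * g (size s + m - i)%N) / g m).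
pose S n := iter n step [::].
have szS n : size (S n) = n by elim: n => //= n IH; rewrite size_rcons IH.
have nthS n k i : (i < n)%N -> (S (n + k)%N)`_i = (S n)`_i.
  move=> lt_in; elim: k => [|k IH]; first by rewrite addn0.
  by rewrite addnS /= nth_rcons szS ltn_addr.
pose h n := (S n.+1)`_n.
have hE n : h n * g m = f (n + m)%N - \sum_(i < n) h i * g (n + m - i)%N.
  rewrite {1}/h /= nth_rcons szS ltnn eqxx divfK //; congr (_ - _).
  apply: eq_bigr => i _; congr (_ * _); rewrite /h.
  by rewrite -{1}(subnKC (ltn_ord i)) nthS.
exists h; apply/funext => p; have [pm|mp] := ltnP p m.
  rewrite /fps_mul f0 // big1 // => i _; rewrite g0 ?mulr0 //; lia.
by rewrite -(subnK mp) fps_mul_order // hE addrC subrK.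
Qed.

Lemma fps_divP f g m :
  (forall i, (i < m)%N -> g i = 0) -> g m != 0 ->
  (forall i, (i < m)%N -> f i = 0) -> fps_mul (fps_div f g) g = f.
Proof.
by move=> g0 gm /(fps_div_exists g0 gm)[h hP]; rewrite /fps_div; case: xgetP => [_ _ //|/(_ h)].
Qed.

Lemma degen_bernoulliP mu :
  fps_mul (egf (degen_bernoulli mu)) (degen_exp mu \- fps_const 1) = fps_X.
Proof.
have -> : egf (degen_bernoulli mu) = fps_div fps_X (degen_exp mu \- fps_const 1).
  by apply/funext => n; rewrite /egf /degen_bernoulli mulrC mulKf // pnatr_eq0 -lt0n fact_gt0.
apply: (@fps_divP _ _ 1); last by case.
- case=> // _; rewrite /degen_exp /egf /fps_const /degen_ffact /= big_ord0 hornerC.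
  by rewrite fact0 divr1 subrr.
- rewrite /degen_exp /egf /fps_const /degen_ffact /= big_ord1 !hornerE.
  by rewrite !subr0 divr1 oner_eq0.
Qed.

Lemma degen_eulerP mu :
  fps_mul (egf (degen_euler mu)) (degen_exp mu \+ fps_const 1) = fps_const 2.
Proof.
have -> : egf (degen_euler mu) = fps_div (fps_const 2) (degen_exp mu \+ fps_const 1).
  by apply/funext => n; rewrite /egf /degen_euler mulrC mulKf // pnatr_eq0 -lt0n fact_gt0.
apply: (@fps_divP _ _ 0) => //.
rewrite /degen_exp /egf /fps_const /degen_ffact /= big_ord0 hornerC fact0 divr1.
by rewrite -[1 + 1]/(2%:R) pnatr_eq0.
Qed.

Lemma size_degen_ffact mu n : size (degen_ffact mu n) = n.+1.
Proof. by rewrite size_prod_XsubC /index_enum -enumT size_enum_ord. Qed.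

Lemma degen_ffactS mu n :
  degen_ffact mu n.+1 = degen_ffact mu n * ('X - (n%:R * mu)%:P).
Proof. by rewrite /degen_ffact big_ord_recr. Qed.

Lemma degen_stirling2P mu n : is_degen_stirling2 mu n (degen_stirling2 mu n).
Proof.
suff [s sP] : exists s, is_degen_stirling2 mu n s.
  by rewrite /degen_stirling2; case: xgetP => [_ _ //|/(_ s)].
elim: n => [|n [s [s0 sE]]].
  exists (fps_const 1); split; first by case.
  by rewrite big_ord1 /degen_ffact !big_ord0 scale1r.
exists (fun k => (if k is j.+1 then s j else 0) + (k%:R - n%:R * mu) * s k).
split=> [[//|k] nk|]; first by rewrite !s0 ?mulr0 ?addr0 // ltnW.
rewrite degen_ffactS sE mulr_suml.
under [RHS]eq_bigr => k _ do rewrite scalerDl.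
rewrite big_split /= [X in _ = X + _]big_ord_recl /= scale0r add0r.
rewrite [X in _ = _ + X]big_ord_recr /= [s n.+1]s0 // mulr0 scale0r addr0.
rewrite -big_split; apply: eq_bigr => k _ /=.
rewrite /bump leq0n add1n add0n degen_ffactS mulr1 -!mul_polyC; ring.
Qed.

Lemma degen_ffact_free (s : nat -> R) n :
  \sum_(k < n) s k *: degen_ffact 1 k = 0 -> forall k, (k < n)%N -> s k = 0.
Proof.
elim: n => [//|n IH]; rewrite big_ord_recr /= => E.
have sn : s n = 0.
  have := congr1 (fun p : {poly R} => p`_n) E; rewrite coefD coef_sum coef0.
  rewrite big1 => [|i _]; last by rewrite coefZ nth_default ?mulr0 // size_degen_ffact.
  have : lead_coef (degen_ffact 1 n) = 1 by apply/monicP/monic_prod_XsubC.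
  by rewrite lead_coefE size_degen_ffact add0r coefZ /= => ->; rewrite mulr1.
move: E; rewrite sn scale0r addr0 => /IH s0 k.
by rewrite ltnS leq_eqVlt => /orP[/eqP->|/s0].
Qed.

Lemma degen_stirling2_uniq mu n s :
  is_degen_stirling2 mu n s -> s = degen_stirling2 mu n.
Proof.
move=> [s0 sE]; have [t0 tE] := degen_stirling2P mu n.
apply/funext => k; have [nk|kn] := ltnP n k; first by rewrite s0 ?t0.
apply/eqP; rewrite -subr_eq0; apply/eqP.
apply: (@degen_ffact_free (s \- degen_stirling2 mu n) n.+1) => //.
under eq_bigr => i _ do rewrite scalerBl.
by rewrite big_split /= sumrN -sE -tE subrr.
Qed.

End PowerSeries.

(* Main.v *)
Require Import Defs.
From mathcomp Require Import all_boot all_order all_algebra.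
From mathcomp Require Import reals.
From mathcomp Require Import boolp ring zify.

Set Implicit Arguments.
Unset Strict Implicit.
Unset Printing Implicit Defensive.

Import Order.TTheory GRing.Theory Num.Theory.
Local Open Scope ring_scope.

(** Write [E] for the series [degen_exp lambda], that is
    (1 + lambda t)^(1/lambda).  The three quantities are the coefficients
    of t^n / n! in - t / (E + 1).

    Bernoulli side.  The Vandermonde convolution ([degen_vandermonde]) gives
    E^2 = (1 + lambda t)^(2/lambda), which is [degen_exp (lambda / 2)] taken
    at 2 t.  Hence 2^n beta_{n, lambda/2} are the coefficients of
    2 t / (E^2 - 1), and
      2 t / (E^2 - 1) - t / (E - 1) = - t / (E + 1) = - (t / 2) (2 / (E + 1));
    the right-hand side generates the numbers - (n / 2) Euler_{n-1}
    ([bernoulli_double_euler]).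

    Stirling side.  Formally 2 / (E + 1) is the sum of (-1/2)^k (E - 1)^k.
    Composition of series is avoided by an umbral argument: on functions of x,
    the shift by 1 is 1 + D with D the forward difference, and the functional
      L f = sum_(k < N) (-1/2)^k (D^k f)(0)
    is a truncation of 2 / (2 + D) followed by evaluation at 0, so that
    L (f(x + 1)) + L (f(x)) = 2 f(0) up to the term in D^N, by telescoping
    ([euler_functional_shift]).  On f = (x)_{n, mu} with n < N that term
    vanishes, because D^k f (0) = k! S(n, k) ([iter_diff_degen_ffact]), and
    Vandermonde expands f(x + 1) in the (x)_{j, mu}.  The numbers L ((x)_{n, mu}) therefore
    satisfy the recurrence that characterizes the degenerate Euler numbers
    ([degen_euler_stirling2]). *)

(** * Algebra of formal power series *)

Section PowerSeriesAlgebra.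
Variable R : realType.
Implicit Types (f g h a : nat -> R) (c mu : R).

(* The ring laws of [fps_mul] are inherited from polynomials: only the
   coefficients below [N] of a product truncated at [N] are relevant. *)
Let trunc (N : nat) f : {poly R} := \poly_(i < N) f i.

Let coef_trunc N f i : (i < N)%N -> (trunc N f)`_i = f i.
Proof. by move=> iN; rewrite coef_poly iN. Qed.

Let coef_truncM N f g n : (n < N)%N ->
  (trunc N f * trunc N g)`_n = fps_mul f g n.
Proof.
move=> nN; rewrite coefM; apply: eq_bigr => i _.
by rewrite !coef_trunc //; have := ltn_ord i; lia.
Qed.

Lemma fps_mulC f g : fps_mul f g = fps_mul g f.
Proof. by apply/funext => n; rewrite -!(@coef_truncM n.+1) // mulrC. Qed.

Lemma fps_mulA f g h : fps_mul f (fps_mul g h) = fps_mul (fps_mul f g) h.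
Proof.
apply/funext => n.
transitivity ((trunc n.+1 f * (trunc n.+1 g * trunc n.+1 h))`_n).
  rewrite coefM; apply: eq_bigr => i _; have := ltn_ord i => ?.
  by rewrite coef_trunc ?coef_truncM //; lia.
rewrite mulrA coefM; apply: eq_bigr => i _; have := ltn_ord i => ?.
by rewrite coef_trunc ?coef_truncM //; lia.
Qed.

Lemma fps_mulDl f g h : fps_mul (f \+ g) h = fps_mul f h \+ fps_mul g h.
Proof.
by apply/funext => n /=; rewrite /fps_mul -big_split; apply: eq_bigr => i _; rewrite mulrDl.
Qed.

Lemma fps_mulBl f g h : fps_mul (f \- g) h = fps_mul f h \- fps_mul g h.
Proof.
by apply/funext => n /=; rewrite /fps_mul -sumrB; apply: eq_bigr => i _; rewrite mulrBl.
Qed.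

Lemma fps_mulDr f g h : fps_mul h (f \+ g) = fps_mul h f \+ fps_mul h g.
Proof. by rewrite fps_mulC fps_mulDl !(fps_mulC h). Qed.

Lemma fps_mulBr f g h : fps_mul h (f \- g) = fps_mul h f \- fps_mul h g.
Proof. by rewrite fps_mulC fps_mulBl !(fps_mulC h). Qed.

Lemma fps_const_mul c f n : fps_mul (fps_const c) f n = c * f n.
Proof.
rewrite /fps_mul big_ord_recl subn0 /= big1 ?addr0 // => i _.
by rewrite mul0r.
Qed.

Lemma fps_mulf1 f : fps_mul f (fps_const 1) = f.
Proof. by apply/funext => n; rewrite fps_mulC fps_const_mul mul1r. Qed.

Lemma fps_X_mulS f n : fps_mul (@fps_X R) f n.+1 = f n.
Proof.
rewrite /fps_mul !big_ord_recl /= /bump /= mul0r mul1r add0r subSS subn0.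
by rewrite big1 ?addr0 // => i _; rewrite mul0r.
Qed.

Lemma fact_neq0 n : n`!%:R != 0 :> R.
Proof. by rewrite pnatr_eq0 -lt0n fact_gt0. Qed.

Lemma egfE a n : n`!%:R * egf a n = a n.
Proof. by rewrite mulrC divfK // fact_neq0. Qed.

Definition fps_dilate c f : nat -> R := fun n => c ^+ n * f n.

Lemma fps_dilateM c f g :
  fps_mul (fps_dilate c f) (fps_dilate c g) = fps_dilate c (fps_mul f g).
Proof.
apply/funext => n; rewrite /fps_dilate /fps_mul mulr_sumr.
apply: eq_bigr => i _.
have -> : c ^+ n = c ^+ i * c ^+ (n - i).
  by rewrite -exprD subnKC // -ltnS.
by rewrite mulrACA.
Qed.

End PowerSeriesAlgebra.

(** * The Vandermonde convolution *)

Section DegenerateVandermonde.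
Variables (R : realType) (mu : R).

(** The series (1 + mu t)^(x / mu), to be read as exp (x t) when mu = 0. *)
Definition degen_power (x : R) : nat -> R :=
  egf (fun n => (degen_ffact mu n).[x]).

Lemma degen_ffact0E (x : R) : (degen_ffact mu 0).[x] = 1.
Proof. by rewrite /degen_ffact big_ord0 hornerC. Qed.

Lemma degen_ffactSE (x : R) n :
  (degen_ffact mu n.+1).[x] = (degen_ffact mu n).[x] * (x - n%:R * mu).
Proof. by rewrite degen_ffactS hornerM hornerXsubC. Qed.

Lemma degen_power0 (x : R) : degen_power x 0%N = 1.
Proof. by rewrite /degen_power /egf degen_ffact0E fact0 divr1. Qed.

(** The coefficient form of the differential equation
    (1 + mu t) f'(t) = x f(t) of (1 + mu t)^(x / mu). *)
Lemma degen_powerS (x : R) n :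
  n.+1%:R * degen_power x n.+1 = (x - n%:R * mu) * degen_power x n.
Proof.
rewrite /degen_power /egf degen_ffactSE factS natrM.
by field; rewrite nat1r fact_neq0 pnatr_eq0.
Qed.

(** Splitting the factor n.+1 = i + (n.+1 - i) in the product is the Leibniz
    rule; both sides then satisfy the recurrence [degen_powerS] at x + y. *)
Lemma degen_vandermonde (x y : R) :
  fps_mul (degen_power x) (degen_power y) = degen_power (x + y).
Proof.
apply/funext; elim=> [|n IH].
  by rewrite /fps_mul big_ord1 !degen_power0 mulr1.
apply: (@mulfI _ n.+1%:R); first by rewrite pnatr_eq0.
rewrite degen_powerS -IH /fps_mul !mulr_sumr.
have split_fact (i : 'I_n.+2) : n.+1%:R * (degen_power x i * degen_power y (n.+1 - i)) =
    (i%:R * degen_power x i) * degen_power y (n.+1 - i) +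
    degen_power x i * ((n.+1 - i)%N%:R * degen_power y (n.+1 - i)).
  have -> : n.+1%:R = i%:R + (n.+1 - i)%N%:R :> R.
    by rewrite -natrD subnKC // -ltnS.
  ring.
under eq_bigr => i _ do rewrite split_fact.
rewrite big_split big_ord_recl /= !mul0r add0r.
rewrite [X in _ + X]big_ord_recr /= subnn mul0r mulr0 addr0 -big_split.
apply: eq_bigr => i _ /=; rewrite /bump leq0n add1n subSS.
have lein : (i <= n)%N by rewrite -ltnS.
rewrite (subSn lein) !degen_powerS (natrB _ lein); ring.
Qed.

End DegenerateVandermonde.

(** * Euler numbers from Stirling numbers *)

Section StirlingEuler.
Variable R : realType.
Implicit Types (f : R -> R) (mu : R).

Definition diff f : R -> R := fun x => f (x + 1) - f x.

Lemma iter_diff_sum k m (c : 'I_m -> R) (f : 'I_m -> R -> R) :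
  iter k diff (fun x => \sum_i c i * f i x) =
  (fun x => \sum_i c i * iter k diff (f i) x).
Proof.
elim: k => //= k ->; apply/funext => x; rewrite /diff -sumrB.
by apply: eq_bigr => i _; rewrite mulrBr.
Qed.

Lemma iter_diffZ k (c : R) f :
  iter k diff (fun x => c * f x) = (fun x => c * iter k diff f x).
Proof.
have := @iter_diff_sum k 1 (fun=> c) (fun=> f).
have sum1 (g : R -> R) : (fun x => \sum_(i < 1) c * g x) = (fun x => c * g x).
  by apply/funext => x; rewrite big_ord1.
by rewrite !sum1.
Qed.

Lemma ffact_shift j (x : R) :
  (degen_ffact 1 j.+1).[x + 1] = (x + 1) * (degen_ffact 1 j).[x].
Proof.
elim: j => [|j IH]; first by rewrite degen_ffactSE !degen_ffact0E; ring.
by rewrite degen_ffactSE IH degen_ffactSE -natr1; ring.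
Qed.

Lemma diff_ffact j :
  diff (fun x => (degen_ffact 1 j).[x]) =
  (fun x => j%:R * (degen_ffact 1 j.-1).[x]).
Proof.
apply/funext => x; rewrite /diff; case: j => [|j].
  by rewrite !degen_ffact0E subrr mul0r.
by rewrite ffact_shift degen_ffactSE -natr1 /=; ring.
Qed.

Lemma iter_diff_ffact0 k j :
  iter k diff (fun x => (degen_ffact 1 j).[x]) 0 = k`!%:R *+ (j == k).
Proof.
elim: k j => [|k IH] j.
  rewrite /= fact0; case: j => [|j]; first by rewrite degen_ffact0E.
  rewrite /degen_ffact horner_prod big_ord_recl /= hornerXsubC.
  by rewrite mul0r subr0 mul0r.
rewrite iterSr diff_ffact iter_diffZ IH; case: j => [|j] /=.
  by rewrite mul0r.
by rewrite eqSS; case: eqP => [->|_]; rewrite ?mulr0 // factS natrM.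
Qed.

(** Newton's forward difference formula: the coordinates of a polynomial in
    the basis of falling factorials are its differences at 0. *)
Lemma iter_diff_degen_ffact mu n k :
  iter k diff (fun x => (degen_ffact mu n).[x]) 0 =
  k`!%:R * degen_stirling2 mu n k.
Proof.
have [s0 sE] := degen_stirling2P mu n.
have -> : (fun x => (degen_ffact mu n).[x]) =
    (fun x => \sum_(j < n.+1) degen_stirling2 mu n j * (degen_ffact 1 j).[x]).
  apply/funext => x; rewrite {1}sE horner_sum.
  by apply: eq_bigr => j _; rewrite hornerZ.
rewrite iter_diff_sum.
under eq_bigr => j _ do rewrite iter_diff_ffact0 mulrnAr mulrb.
rewrite -big_mkcond /=; have [nk|kn] := ltnP n k.
  rewrite s0 // mulr0 big1 // => j /eqP jk; have := ltn_ord j; lia.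
rewrite (big_pred1 (Ordinal (kn : (k < n.+1)%N))) /=; first by rewrite mulrC.
by move=> j; rewrite /= -val_eqE.
Qed.

(** The functional of the operator 2 / (2 + D), expanded as a geometric
    series in the difference D and truncated at order [N]. *)
Definition euler_functional N f : R :=
  \sum_(k < N) (- 2^-1) ^+ k * iter k diff f 0.

Lemma euler_functional_sum N m (c : 'I_m -> R) (f : 'I_m -> R -> R) :
  euler_functional N (fun x => \sum_i c i * f i x) =
  \sum_i c i * euler_functional N (f i).
Proof.
rewrite /euler_functional.
under eq_bigr => k _ do rewrite iter_diff_sum mulr_sumr.
rewrite exchange_big; apply: eq_bigr => i _; rewrite mulr_sumr.
by apply: eq_bigr => k _; rewrite mulrCA.
Qed.

Lemma iter_diff_shift k f x :
  iter k diff (fun x => f (x + 1)) x = iter k diff f (x + 1).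
Proof. by elim: k x => //= k IH x; rewrite /diff !IH. Qed.

(** The shift by 1 is 1 + D, so the left-hand side is the functional at
    2 f + D f: the sum telescopes. *)
Lemma euler_functional_shift N f :
  euler_functional N (fun x => f (x + 1)) + euler_functional N f =
  2 * f 0 - 2 * (- 2^-1) ^+ N * iter N diff f 0.
Proof.
elim: N => [|N IH].
  by rewrite /euler_functional !big_ord0 expr0 /=; ring.
rewrite /euler_functional !big_ord_recr /= -/(euler_functional _ _).
rewrite -/(euler_functional N f) addrACA IH iter_diff_shift exprS /diff.
by field.
Qed.

(** The expansion of 2 / (E + 1) in powers of E - 1, obtained through the
    recurrence that defines the Euler numbers: by uniqueness of quotients it
    is enough to multiply the right-hand side by E + 1. *)
Lemma degen_euler_stirling2 mu n :
  degen_euler mu n =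
  \sum_(k < n.+1) degen_stirling2 mu n k * (- 2^-1) ^+ k * k`!%:R.
Proof.
pose a n : R := \sum_(k < n.+1) degen_stirling2 mu n k * (- 2^-1) ^+ k * k`!%:R.
(* The truncation order is immaterial once it exceeds the degree. *)
have aE N j : (j < N)%N ->
    euler_functional N (fun x => (degen_ffact mu j).[x]) = a j.
  move=> jN; rewrite /euler_functional /a.
  rewrite (big_ord_widen N (fun k => degen_stirling2 mu j k * (- 2^-1) ^+ k * k`!%:R) jN).
  rewrite [RHS]big_mkcond; apply: eq_bigr => k _; rewrite iter_diff_degen_ffact.
  case: ltnP => jk; first by ring.
  by rewrite (degen_stirling2P mu j).1 // !mulr0.
suff /(congr1 (fun g : nat -> R => n`!%:R * g n)) : egf (degen_euler mu) = egf a.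
  by rewrite !egfE.
apply: (@fps_mul_inj _ (degen_exp mu \+ fps_const 1) 0) => //.
  rewrite -[degen_exp mu]/(degen_power mu 1) /= degen_power0.
  by rewrite -[_ + _]/(2%:R) pnatr_eq0.
rewrite degen_eulerP fps_mulDr fps_mulf1; apply/funext => m.
(* The recurrence at [m] is the functional applied to x |-> (x + 1)_{m, mu}
   and to (x)_{m, mu}, the former expanded by Vandermonde. *)
set f := fun x : R => (degen_ffact mu m).[x].
have vdm : (fun x => f (x + 1)) = (fun x => \sum_(i < m.+1)
    (m`!%:R / i`!%:R * degen_power mu 1 (m - i)) * (degen_ffact mu i).[x]).
  apply/funext => x.
  have := congr1 (fun g : nat -> R => m`!%:R * g m) (degen_vandermonde mu x 1).
  rewrite egfE /f => <-; rewrite /fps_mul mulr_sumr; apply: eq_bigr => i _.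
  by rewrite {1}/degen_power /egf; ring.
have := euler_functional_shift m.+1 f.
rewrite iter_diff_degen_ffact (degen_stirling2P mu m).1 // !mulr0 subr0.
rewrite vdm euler_functional_sum aE //.
under eq_bigr => i _ do rewrite aE //.
move=> key; apply: (@mulfI _ m`!%:R); first exact: fact_neq0.
transitivity (2 * f 0).
  rewrite /f /fps_const; case: m {f vdm key} => [|m].
    by rewrite degen_ffact0E fact0 mul1r mulr1.
  rewrite /degen_ffact horner_prod big_ord_recl /= hornerXsubC.
  by rewrite mul0r subr0 mul0r !mulr0.
rewrite -key /= mulrDr /fps_mul mulr_sumr; congr (_ + _).
  by apply: eq_bigr => i _; rewrite /egf /degen_power /degen_exp /egf; ring.
exact/esym/egfE.
Qed.

End StirlingEuler.

(** * Bernoulli numbers and Euler numbers *)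

Section BernoulliEuler.
Variables (R : realType) (mu : R).

(** (1 + (mu / 2) (2 t))^(1 / (mu / 2)) = (1 + mu t)^(2 / mu). *)
Lemma degen_exp_half_dilate :
  fps_dilate 2 (degen_exp (mu / 2)) = degen_power mu 2.
Proof.
apply/funext => n; rewrite /fps_dilate /degen_exp /degen_power /egf mulrA.
congr (_ / _); elim: n => [|n IH]; first by rewrite !degen_ffact0E mulr1.
by rewrite !degen_ffactSE -IH exprS; field.
Qed.

(** The partial fraction 2 t / (E^2 - 1) = t / (E - 1) - t / (E + 1), checked
    after multiplication by E^2 - 1. *)
Lemma bernoulli_double_series :
  fps_dilate 2 (egf (degen_bernoulli (mu / 2))) =
  egf (degen_bernoulli mu) \-
    fps_mul (fps_const 2^-1) (fps_mul (@fps_X R) (egf (degen_euler mu))).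
Proof.
set B := egf (degen_bernoulli mu); set Eu := egf (degen_euler mu).
set E := degen_exp mu; pose one : nat -> R := fps_const 1.
have sq : degen_power mu 2 \- one = fps_mul (E \- one) (E \+ one).
  rewrite fps_mulDr fps_mulf1 fps_mulBl -[2]/(1 + 1).
  rewrite -degen_vandermonde -/E [fps_mul one _]fps_mulC fps_mulf1.
  by apply/funext => n /=; rewrite /E /degen_exp /degen_power; ring.
apply: (@fps_mul_inj _ (degen_power mu 2 \- one) 1).
- by case=> // _; rewrite /= degen_power0 subrr.
- rewrite /= /one /fps_const subr0.
  have := degen_powerS mu 2 0; rewrite mul1r degen_power0 mul0r subr0 mulr1 => ->.
  by rewrite pnatr_eq0.
transitivity (fps_dilate 2 (@fps_X R)).
  rewrite -(degen_bernoulliP (mu / 2)) -fps_dilateM; congr fps_mul.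
  rewrite -degen_exp_half_dilate; apply/funext => n.
  rewrite /fps_dilate /one /fps_const /= mulrBr.
  by case: n => [|n]; rewrite ?mulr1 ?mulr0.
rewrite sq fps_mulBl fps_mulA degen_bernoulliP.
rewrite -!fps_mulA [fps_mul Eu _]fps_mulC -fps_mulA.
rewrite [fps_mul _ Eu]fps_mulC degen_eulerP fps_mulDr fps_mulf1.
rewrite [fps_mul (E \- one) _]fps_mulC.
rewrite [fps_mul (@fps_X R) (fps_mul _ _)]fps_mulA.
rewrite [fps_mul (@fps_X R) (fps_const 2)]fps_mulC -!fps_mulA.
apply/funext => n /=; rewrite !fps_const_mul fps_mulBr fps_mulf1 /=.
rewrite mulrA mulVf ?pnatr_eq0 // mul1r /fps_dilate /fps_X.
by case: n => [|[|n]] /=; ring.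
Qed.

Lemma bernoulli_double_euler m :
  2 ^+ m.+1 * degen_bernoulli (mu / 2) m.+1 - degen_bernoulli mu m.+1 =
  - (m.+1%:R / 2) * degen_euler mu m.
Proof.
have := congr1 (fun f : nat -> R => m.+1`!%:R * f m.+1) bernoulli_double_series.
rewrite /= /fps_dilate fps_const_mul fps_X_mulS /egf.
have m0 := @fact_neq0 R m.
have m1 : m.+1%:R != 0 :> R by rewrite pnatr_eq0.
set b := degen_bernoulli _ _; set c := degen_bernoulli _ _.
rewrite factS natrM => key.
have -> : 2 ^+ m.+1 * b =
  m.+1%:R * m`!%:R * (2 ^+ m.+1 * (b / (m.+1%:R * m`!%:R))).
  by field; rewrite m0 nat1r m1.
by rewrite key; field; rewrite m0 nat1r m1.
Qed.

End BernoulliEuler.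

Theorem theorem2p7 (R : realType) (lambda : R) (hlambda : lambda != 0)
    (n : nat) (hn : (1 <= n)%N) :
  2 ^+ n * degen_bernoulli (lambda / 2) n - degen_bernoulli lambda n =
    n%:R * \sum_(0 <= k < n) degen_stirling2 lambda n.-1 k *
      (-1) ^ (k%:Z - 1) * k`!%:R * 2 ^ (- k%:Z - 1)
  /\
  n%:R * (\sum_(0 <= k < n) degen_stirling2 lambda n.-1 k *
      (-1) ^ (k%:Z - 1) * k`!%:R * 2 ^ (- k%:Z - 1)) =
    - (n%:R / 2) * degen_euler lambda n.-1.
Proof.
case: n hn => // m _ /=.
have stirling_euler : m.+1%:R * (\sum_(0 <= k < m.+1) degen_stirling2 lambda m k *
    (-1) ^ (k%:Z - 1) * k`!%:R * 2 ^ (- k%:Z - 1)) =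
    - (m.+1%:R / 2) * degen_euler lambda m.
  rewrite degen_euler_stirling2 big_mkord mulNr -mulrA -mulrN; congr (_ * _).
  rewrite mulr_sumr -sumrN; apply: eq_bigr => k _.
  rewrite !expfzDr ?oppr_eq0 ?oner_eq0 ?pnatr_eq0 // !exprN1 invrN1.
  by rewrite -invr_expz -!exprnP [(- 2^-1) ^+ k]exprNn exprVn; ring.
by split=> //; rewrite stirling_euler bernoulli_double_euler.
Qed.
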